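(* For every integer $n\ge 2$, the last decimal digit of the tangent number $T_n$ is $2$ if $n$ is even and $6$ if $n$ is odd. More precisely, for any integer $n\ge 1$, $$T_n\equiv\begin{cases}1 \pmod 5 & \text{if } n \text{ is odd},\\ 2 \pmod 5 & \text{if } n\text{ is even}.\end{cases}$$
   Context: For $n\ge1$, the $n$-th tangent number is $T_n:=(-1)^n2^{2n}(1-2^{2n})\frac{B_{2n}}{2n}$, where $B_n$ is the $n$-th Bernoulli number, defined by $\frac{t}{e^t-1}=\sum_{n\ge0}B_n\frac{t^n}{n!}$. Equivalently, $\tan x=\sum_{n\ge1}T_n\frac{x^{2n-1}}{(2n-1)!}$ around $x=0$. It is a known fact that every $T_n$ is an integer. *)

(* Defs.v *)
From mathcomp Require Import all_boot all_order all_algebra.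
Set Implicit Arguments.
Unset Strict Implicit.
Unset Printing Implicit Defensive.
Import GRing.Theory.
Local Open Scope ring_scope.

(* Formal power series over the rationals, as sequences of coefficients. *)
Definition fps := nat -> rat.

Definition fps_mul (f g : fps) : fps :=
  fun n => \sum_(i < n.+1) f i * g (n - i)%N.

Definition fps_sub (f g : fps) : fps := fun n => f n - g n.

Definition fps_one : fps := fun n => (n == 0%N)%:R.

Definition fps_X : fps := fun n => (n == 1%N)%:R.

(* [egf a] is the series \sum_n a_n t^n / n!. *)
Definition egf (a : nat -> rat) : fps := fun n => a n / n`!%:R.

Definition fps_exp : fps := egf (fun _ => 1).

(* The identity t / (e^t - 1) = \sum_n B_n t^n / n!.  The series e^t - 1 has
   zero constant term, hence no inverse, but it is not a zero divisor: the
   quotient is the unique series whose product with e^t - 1 is t. *)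
Definition bernoulli_gf (B : nat -> rat) : Prop :=
  fps_mul (egf B) (fps_sub fps_exp fps_one) =1 fps_X.

Lemma fact_neq0 n : n`!%:R != 0 :> rat.
Proof. by rewrite Num.Theory.pnatr_eq0 -lt0n fact_gt0. Qed.

Lemma bernoulli_gfE B : bernoulli_gf B <->
  forall n, B n / n`!%:R
    = (n == 0%N)%:R - \sum_(i < n) B i / i`!%:R / (n.+1 - i)`!%:R.
Proof.
have D0 : fps_sub fps_exp fps_one 0%N = 0.
  by rewrite /fps_sub /fps_exp /fps_one /egf fact0 divr1 subrr.
have D k : (0 < k)%N -> fps_sub fps_exp fps_one k = k`!%:R^-1.
  by case: k => // k _; rewrite /fps_sub /fps_exp /fps_one /egf subr0 mul1r.
have E n : fps_mul (egf B) (fps_sub fps_exp fps_one) n.+1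
    = \sum_(i < n) B i / i`!%:R / (n.+1 - i)`!%:R + B n / n`!%:R.
  rewrite /fps_mul big_ord_recr /= subnn D0 mulr0 addr0.
  rewrite big_ord_recr /= subSnn D // invr1 mulr1; congr (_ + _).
  by apply: eq_bigr => i _; rewrite D // subn_gt0 ltnS ltnW.
split=> [gfB n | recB [|n]].
- by have := gfB n.+1; rewrite E /fps_X eqSS => <-; rewrite addrAC subrr add0r.
- by rewrite /fps_mul big_ord1 D0 mulr0.
- by rewrite E recB /fps_X eqSS addrC subrK.
Qed.

Lemma bernoulli_gf_unique B C : bernoulli_gf B -> bernoulli_gf C -> B =1 C.
Proof.
move=> /bernoulli_gfE recB /bernoulli_gfE recC.
elim/ltn_ind=> n IHn; apply: (mulIf (invr_neq0 (fact_neq0 n))).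
rewrite recB recC; congr (_ - _).
by apply: eq_bigr => i _; rewrite IHn.
Qed.

Lemma bernoulli_exists : {B : nat -> rat | bernoulli_gf B}.
Proof.
pose g n (s : seq rat) : rat := n`!%:R *
  ((n == 0%N)%:R - \sum_(i < n) s`_i / i`!%:R / (n.+1 - i)`!%:R).
pose fix s n := if n is m.+1 then rcons (s m) (g m (s m)) else [::].
have sz n : size (s n) = n by elim: n => //= n IH; rewrite size_rcons IH.
have sE n i : (i < n)%N -> (s n)`_i = (s i.+1)`_i.
  elim: n => // n IHn; rewrite ltnS leq_eqVlt => /orP[/eqP -> //|lt_in].
  by rewrite [s n.+1]/= nth_rcons sz lt_in IHn.
exists (fun n => (s n.+1)`_n); apply/bernoulli_gfE => n.
rewrite {1}[s n.+1]/= nth_rcons sz ltnn eqxx /g mulrC mulKf ?fact_neq0 //.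
by congr (_ - _); apply: eq_bigr => i _; rewrite (sE n).
Qed.

Definition bernoulli : nat -> rat := sval bernoulli_exists.

Lemma bernoulliP : bernoulli_gf bernoulli.
Proof. exact: svalP bernoulli_exists. Qed.

Definition tangent_number (n : nat) : rat :=
  (-1) ^+ n * 2 ^+ (2 * n) * (1 - 2 ^+ (2 * n))
    * (bernoulli (2 * n) / (2 * n)%:R).

Definition last_digit (z : int) : nat := (`|z| %% 10)%N.

(* Main.v *)
Require Import Defs.
From mathcomp Require Import all_boot all_order all_algebra.
From HB Require Import structures.
From mathcomp Require Import boolp.
From mathcomp Require Import zify ring.
Import GRing.Theory.
Local Open Scope ring_scope.

(** Up to explicit factors, the Bernoulli numbers of even index are the
    coefficients of the hyperbolic tangent h, which satisfies h' = 1 - h^2;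
    iterating this equation computes the derivatives of h by polynomials with
    integer coefficients, on which signs and congruences can be read off.

    From Bernoulli numbers to h.  If b(x) = x / (e^x - 1), then
    x h(x) = x + b(4x) - b(2x), because h = 1 - 2 / (e^(2x) + 1) and
    1 / (e^t + 1) = 1 / (e^t - 1) - 2 / (e^(2t) - 1).
    So h(x) (e^(2x) + 1) = e^(2x) - 1 ([fps_tanhM]), and differentiating this
    gives h' = 1 - h^2 ([fps_deriv_tanh]).

    From h to integer polynomials.  The substitution in tan x = - i h(i x) is
    not rational, so tan itself is avoided; the variable y = - h^2, which becomes
    tan^2 after that substitution, absorbs the signs.  Indeed h' = 1 + y,
    and for a polynomial S,
      (S(y))'' = - (L S)(y),
      L S = 4 y (1 + y)^2 S'' + 2 (1 + y) (1 + 3 y) S'  ([fps_deriv2_tan_sq]).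
    Hence T_(n+1) is the constant term of L^n (1 + y) ([tangent_numberE]).

    Reading off the digits.  L preserves natural coefficients, so T_n is a
    natural number; all values of L are divisible by 2, so T_n is even for
    n >= 2; and
      L (L (1 + y)) = 16 + 136 y + 240 y^2 + 120 y^3 = 1 + y modulo 5,
    so T_n modulo 5 has period 2 and is determined by T_1 = 1 and T_2 = 2.  The
    last digit follows from the residues modulo 2 and 5. *)

(** * The ring of formal power series *)

(** A coefficient of a product of series only depends on finitely many
    coefficients of the factors, so it can be computed in the ring of
    polynomials; the ring laws and the Leibniz rule for series are obtained from
    those of polynomials in this way. *)
Lemma fps_mul_coef (p q : {poly rat}) (f g : fps) n :
    (forall i, (i <= n)%N -> p`_i = f i) ->
    (forall i, (i <= n)%N -> q`_i = g i) ->
  fps_mul f g n = (p * q)`_n.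
Proof.
move=> pf qg; rewrite coefM; apply: eq_bigr => i _.
by rewrite pf ?qg ?leq_subr // -ltnS.
Qed.

Definition fps_trunc n (f : fps) : {poly rat} := \poly_(i < n.+1) f i.

Lemma coef_fps_trunc n f i : (i <= n)%N -> (fps_trunc n f)`_i = f i.
Proof. by move=> le_in; rewrite coef_poly ltnS le_in. Qed.

Lemma fps_mul_trunc n f g i : (i <= n)%N ->
  fps_mul f g i = (fps_trunc n f * fps_trunc n g)`_i.
Proof.
by move=> le_in; apply: fps_mul_coef => j le_ji;
  rewrite coef_fps_trunc // (leq_trans le_ji).
Qed.

Lemma fps_mulC : commutative fps_mul.
Proof.
by move=> f g; apply/funext => n; rewrite !(@fps_mul_trunc n) // mulrC.
Qed.

Lemma fps_mulA : associative fps_mul.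
Proof.
move=> f g h; apply/funext => n.
have lhs := @fps_mul_coef (fps_trunc n f) (fps_trunc n g * fps_trunc n h)
  f (fps_mul g h) n.
have rhs := @fps_mul_coef (fps_trunc n f * fps_trunc n g) (fps_trunc n h)
  (fps_mul f g) h n.
rewrite lhs ?rhs ?mulrA // => i le_in; rewrite ?coef_fps_trunc //;
  by rewrite -fps_mul_trunc.
Qed.

Lemma fps_mul1 : left_id fps_one fps_mul.
Proof.
move=> f; apply/funext => n.
rewrite (@fps_mul_coef 1 (fps_trunc n f)) ?mul1r ?coef_fps_trunc // => i le_in.
  by rewrite coef1.
by rewrite coef_fps_trunc.
Qed.

Definition fps_zero : fps := fun=> 0.
Definition fps_opp (f : fps) : fps := fun n => - f n.
Definition fps_add (f g : fps) : fps := fun n => f n + g n.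

Lemma fps_addA : associative fps_add.
Proof. by move=> f g h; apply/funext => n; apply: addrA. Qed.

Lemma fps_addC : commutative fps_add.
Proof. by move=> f g; apply/funext => n; apply: addrC. Qed.

Lemma fps_add0 : left_id fps_zero fps_add.
Proof. by move=> f; apply/funext => n; apply: add0r. Qed.

Lemma fps_addN : left_inverse fps_zero fps_opp fps_add.
Proof. by move=> f; apply/funext => n; apply: addNr. Qed.

Lemma fps_mulDl : left_distributive fps_mul fps_add.
Proof.
move=> f g h; apply/funext => n; rewrite /fps_add /fps_mul -big_split.
by apply: eq_bigr => i _; rewrite mulrDl.
Qed.

Lemma fps_one_neq0 : fps_one != fps_zero :> (nat -> rat).
Proof. by apply/eqP => /(congr1 (@^~ 0%N)). Qed.

HB.instance Definition _ := gen_eqMixin fps.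
HB.instance Definition _ := gen_choiceMixin fps.
HB.instance Definition _ :=
  GRing.isZmodule.Build fps fps_addA fps_addC fps_add0 fps_addN.
HB.instance Definition _ := GRing.Zmodule_isComNzRing.Build fps
  fps_mulA fps_mulC fps_mul1 fps_mulDl fps_one_neq0.

(** * Constant term, derivation and substitution of c x *)

Definition fps_coef0 (f : fps) : rat := f 0%N.

Fact fps_coef0_is_additive : zmod_morphism fps_coef0.
Proof. by []. Qed.

Fact fps_coef0_is_monoid_morphism : monoid_morphism fps_coef0.
Proof.
by split=> [//|f g]; rewrite /fps_coef0 [LHS]big_ord1.
Qed.

HB.instance Definition _ :=
  GRing.isZmodMorphism.Build fps rat fps_coef0 fps_coef0_is_additive.
HB.instance Definition _ :=
  GRing.isMonoidMorphism.Build fps rat fps_coef0 fps_coef0_is_monoid_morphism.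

Definition fps_deriv (f : fps) : fps := fun n => f n.+1 *+ n.+1.

Fact fps_deriv_is_additive : zmod_morphism fps_deriv.
Proof. by move=> f g; apply/funext => n; apply: mulrnBl. Qed.

HB.instance Definition _ :=
  GRing.isZmodMorphism.Build fps fps fps_deriv fps_deriv_is_additive.

Lemma fps_derivM f g : fps_deriv (f * g) = fps_deriv f * g + f * fps_deriv g.
Proof.
apply/funext => n; rewrite [LHS]/fps_deriv [(f * g) _](@fps_mul_trunc n.+1) //.
rewrite -coef_deriv derivM coefD; congr (_ + _); symmetry;
  apply: fps_mul_coef => i le_in; rewrite ?coef_deriv coef_fps_trunc //;
  exact: leqW.
Qed.

Lemma fps_deriv1 : fps_deriv 1 = 0.
Proof. by apply/funext => n; apply: mul0rn. Qed.

Lemma fps_deriv_int (z : int) : fps_deriv z%:~R = 0.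
Proof. by rewrite raddfMz /= fps_deriv1 mul0rz. Qed.

Lemma fps_coef0_iter_deriv n f :
  fps_coef0 (iter n fps_deriv f) = f n * n`!%:R.
Proof.
elim: n f => [|n IHn] f; first exact: (esym (mulr1 _)).
by rewrite iterSr IHn /fps_deriv factS natrM mulrA [f _ * _]mulr_natr.
Qed.

Lemma fps_XM f : fps_X * f = (fun n => if n is m.+1 then f m else 0) :> fps.
Proof.
apply/funext => -[|m]; rewrite [LHS]/(fps_mul _ _ _) /fps_mul.
  by rewrite big_ord1 mul0r.
rewrite !big_ord_recl /= mul0r add0r /fps_X mul1r subSS subn0.
by rewrite big1 ?addr0 // => i _; rewrite mul0r.
Qed.

(** Together with [fps_mul2I], this replaces division by 2 X. *)
Lemma fps_XMI : injective (fun f : fps => fps_X * f : fps).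
Proof.
move=> f g; rewrite !fps_XM => eq_fg; apply/funext => n.
exact: (congr1 (@^~ n.+1) eq_fg).
Qed.

Lemma fps_mul2I : injective (fun f : fps => 2 * f).
Proof.
move=> f g /= eq_fg; apply/funext => n; apply: (@Num.Theory.pmulrnI _ 2) => //=.
by move/(congr1 (@^~ n)): eq_fg; rewrite !mulr_natl !mulr2n.
Qed.

(** The substitution x := c x. *)
Definition fps_scale (c : nat) (f : fps) : fps := fun n => c%:R ^+ n * f n.

Lemma fps_scaleM c f g : fps_scale c (f * g) = fps_scale c f * fps_scale c g.
Proof.
apply/funext => n; rewrite [LHS]mulr_sumr; apply: eq_bigr => i _.
by rewrite /fps_scale mulrACA -exprD subnKC // -ltnS.
Qed.

Lemma fps_scaleB c f g : fps_scale c (f - g) = fps_scale c f - fps_scale c g.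
Proof. by apply/funext => n; apply: mulrBr. Qed.

Lemma fps_scale1 c : fps_scale c 1 = 1.
Proof. by apply/funext => -[|n]; [apply: mulr1 | apply: mulr0]. Qed.

Lemma fps_scaleX c : fps_scale c fps_X = c%:R * fps_X.
Proof.
rewrite mulr_natl; apply/funext => n.
have mulrnE k : ((fps_X : fps) *+ k) n = fps_X n *+ k.
  by elim: k => [//|k IHk]; rewrite !mulrS -IHk.
rewrite mulrnE /fps_scale /fps_X; case: eqP => [->|_].
  by rewrite expr1 mulr1.
by rewrite mulr0 mul0rn.
Qed.

Lemma fps_scale_scale c d f :
  fps_scale c (fps_scale d f) = fps_scale (c * d) f.
Proof. by apply/funext => n; rewrite /fps_scale mulrA -exprMn natrM. Qed.

Lemma fps_scale_exp2 : fps_scale 2 fps_exp = fps_exp * fps_exp.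
Proof.
apply/funext => n; rewrite /fps_scale /fps_exp /egf mul1r.
rewrite -[2%:R](@natrD _ 1 1) natrD exprDn mulr_suml.
apply: eq_bigr => i _; have le_in : (i <= n)%N by rewrite -ltnS.
rewrite !expr1n !mul1r -(bin_fact le_in) !natrM.
have := fact_neq0 i; have := fact_neq0 (n - i).
have : 'C(n, i)%:R != 0 :> rat by rewrite Num.Theory.pnatr_eq0 -lt0n bin_gt0.
move=> ? ? ?; field; apply/and3P; split=> //.
Qed.

Lemma fps_deriv_exp : fps_deriv fps_exp = fps_exp.
Proof.
apply/funext => n; rewrite /fps_deriv /fps_exp /egf -[LHS]mulr_natr factS natrM.
have n1 : n.+1%:R != 0 :> rat by rewrite Num.Theory.pnatr_eq0.
by have n0 := fact_neq0 n; field; rewrite n0 nat1r.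
Qed.

(** * The hyperbolic tangent and the Bernoulli numbers *)

Definition fps_bernoulli : fps := egf bernoulli.

Lemma fps_bernoulliM : fps_bernoulli * (fps_exp - 1) = fps_X.
Proof. by apply/funext => n; apply: bernoulliP. Qed.

(** The series x tanh x. *)
Definition fps_xtanh : fps :=
  fps_X + fps_scale 4 fps_bernoulli - fps_scale 2 fps_bernoulli.

(** After multiplication by E2 - 1, where E2 = e^(2x), the defining equations of
    b(2x) and b(4x) turn both sides into x (E2 - 1)^2.  The factor E2 - 1 can
    be cancelled because its product with b(2x) is 2 x. *)
Lemma fps_xtanhM :
  fps_xtanh * (fps_scale 2 fps_exp + 1) = fps_X * (fps_scale 2 fps_exp - 1).
Proof.
set E2 := fps_scale 2 fps_exp.
have B2 : fps_scale 2 fps_bernoulli * (E2 - 1) = 2 * fps_X.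
  by rewrite -fps_scaleX -fps_bernoulliM fps_scaleM fps_scaleB fps_scale1.
have B4 : fps_scale 4 fps_bernoulli * (E2 * E2 - 1) = 4 * fps_X.
  rewrite -fps_scaleX -fps_bernoulliM fps_scaleM fps_scaleB fps_scale1.
  by rewrite -fps_scaleM -fps_scale_exp2 fps_scale_scale.
have E2_reg (f g : fps) : f * (E2 - 1) = g * (E2 - 1) -> f = g.
  move=> eq_fg; apply: fps_XMI; apply: fps_mul2I.
  by rewrite !mulrA -B2 -!mulrA ![(E2 - 1) * _]mulrC eq_fg.
apply: E2_reg; transitivity
  (fps_X * (E2 * E2 - 1) + fps_scale 4 fps_bernoulli * (E2 * E2 - 1)
     - fps_scale 2 fps_bernoulli * (E2 - 1) * (E2 + 1)).
  by rewrite /fps_xtanh; ring.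
by rewrite B4 B2; ring.
Qed.

Definition fps_tanh : fps := fun n => fps_xtanh n.+1.

Lemma fps_X_tanh : fps_X * fps_tanh = fps_xtanh.
Proof.
rewrite fps_XM; apply/funext => -[|//].
rewrite /fps_xtanh [RHS](rmorphB fps_coef0) rmorphD /=.
by rewrite /fps_coef0 /fps_scale addrK.
Qed.

Lemma fps_tanhM :
  fps_tanh * (fps_scale 2 fps_exp + 1) = fps_scale 2 fps_exp - 1.
Proof. by apply: fps_XMI; rewrite mulrA fps_X_tanh fps_xtanhM. Qed.

Lemma fps_coef0_tanh : fps_coef0 fps_tanh = 0.
Proof.
have := congr1 fps_coef0 fps_tanhM; rewrite rmorphM rmorphD rmorphB rmorph1 /=.
rewrite [fps_coef0 (fps_scale _ _)]mulr1 subrr => /eqP.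
by rewrite mulf_eq0 orbF => /eqP.
Qed.

(** Differentiating h (E2 + 1) = E2 - 1 gives h' (E2 + 1) = 2 E2 (1 - h), and
    (1 + h) (E2 + 1) = 2 E2.  The factor E2 + 1 is removed by means of
    (1 - h) (E2 + 1) = 2, which makes it invertible. *)
Lemma fps_deriv_tanh : fps_deriv fps_tanh = 1 - fps_tanh ^+ 2.
Proof.
move: fps_tanhM; set E2 := fps_scale 2 fps_exp => tanhM.
have dE2 : fps_deriv E2 = 2 * E2.
  rewrite /E2 fps_scale_exp2 fps_derivM fps_deriv_exp; ring.
have dE2D : fps_deriv (E2 + 1) = 2 * E2 by rewrite raddfD /= fps_deriv1 addr0.
have dE2B : fps_deriv (E2 - 1) = 2 * E2 by rewrite raddfB /= fps_deriv1 subr0.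
have dtanhM : fps_deriv fps_tanh * (E2 + 1) = 2 * E2 * (1 - fps_tanh).
  have := congr1 fps_deriv tanhM.
  by rewrite fps_derivM dE2D dE2B => /(canRL (addrK _)) ->; ring.
have inv : (1 - fps_tanh) * (E2 + 1) = 2 :> fps by rewrite mulrBl tanhM; ring.
have sum : (1 + fps_tanh) * (E2 + 1) = 2 * E2 :> fps.
  by rewrite mulrDl tanhM; ring.
apply: fps_mul2I.
transitivity ((1 - fps_tanh) * (fps_deriv fps_tanh * (E2 + 1))).
  by rewrite -inv; ring.
by rewrite dtanhM -sum -inv; ring.
Qed.

(** * Derivatives of the hyperbolic tangent as integer polynomials *)

(** The second derivative acting on polynomials in tan^2: if y = tan^2, then
    y' ^ 2 = 4 y (1 + y)^2 and y'' = 2 (1 + y) (1 + 3 y), whence S(y)'' by the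
    chain rule. *)
Definition tan_step (S : {poly int}) : {poly int} :=
  2 * (2 * 'X * (1 + 'X) ^+ 2 * S^`()^`() + (1 + 'X) * (1 + 3 * 'X) * S^`()).

Definition fps_horner (p : {poly int}) (f : fps) : fps :=
  (map_poly intr p).[f].

Lemma fps_deriv_horner p f :
  fps_deriv (fps_horner p f) = fps_horner p^`() f * fps_deriv f.
Proof.
rewrite /fps_horner; elim/poly_ind: p => [|p c IHp].
  by rewrite deriv0 rmorph0 horner0 mul0r raddf0.
rewrite derivMXaddC !(rmorphD, rmorphM) /= map_polyX map_polyC !hornerE.
rewrite raddfD /= fps_deriv_int addr0 fps_derivM IHp; ring.
Qed.

Lemma fps_coef0_horner p f : fps_coef0 f = 0 ->
  fps_coef0 (fps_horner p f) = (p`_0)%:~R.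
Proof.
move=> f0; rewrite /fps_horner -horner_map /= f0 horner_coef0 !coef_map /=.
by rewrite rmorph_int.
Qed.

(** With this sign, the derivative of the hyperbolic tangent is 1 + tan_sq and
    the coefficients of [tan_step] are nonnegative. *)
Definition tan_sq : fps := - fps_tanh ^+ 2.

(** Here y' = - 2 h (1 + y), so y' ^ 2 = - 4 y (1 + y)^2 and
    y'' = - 2 (1 + y) (1 + 3 y). *)
Lemma fps_deriv2_tan_sq S :
  fps_deriv (fps_deriv (fps_horner S tan_sq)) =
  - fps_horner (tan_step S) tan_sq.
Proof.
have dy : fps_deriv tan_sq = - (2 * fps_tanh * (1 + tan_sq)).
  rewrite /tan_sq raddfN /= expr2 fps_derivM fps_deriv_tanh; ring.
rewrite fps_deriv_horner fps_derivM fps_deriv_horner dy.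
have d1y : fps_deriv (1 + tan_sq) = fps_deriv tan_sq.
  by rewrite raddfD /= fps_deriv1 add0r.
have ddy : fps_deriv (- (2 * fps_tanh * (1 + tan_sq))) =
   - 2 * (1 + tan_sq) * (1 + 3 * tan_sq).
  rewrite raddfN /= !fps_derivM d1y dy fps_deriv_tanh.
  rewrite (fps_deriv_int 2) /tan_sq; ring.
rewrite ddy /fps_horner /tan_step.
rewrite !(rmorphD, rmorphM, rmorphXn, rmorph1, rmorph_nat) /= !map_polyX.
rewrite -!(polyC_natr, polyC1).
rewrite !(hornerD, hornerM, horner_exp, hornerX, hornerC).
by rewrite /tan_sq; ring.
Qed.

Lemma iter_deriv2_tan_sq n S :
  iter (2 * n) fps_deriv (fps_horner S tan_sq) =
  (-1) ^+ n * fps_horner (iter n tan_step S) tan_sq.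
Proof.
elim: n S => [|n IHn] S; first by rewrite mul1r.
rewrite mulnS add2n 2!iterSr fps_deriv2_tan_sq iterSr exprSr -mulrA mulN1r.
have iterN k f : iter k fps_deriv (- f) = - iter k fps_deriv f.
  by elim: k => //= k ->; rewrite raddfN.
by rewrite iterN IHn mulrN.
Qed.

(** The derivative of order 2n + 1 of tan, as a polynomial in tan^2. *)
Definition tan_poly n : {poly int} := iter n tan_step (1 + 'X).

Lemma tanh_coefE n :
  fps_tanh (2 * n).+1%N * (2 * n).+1`!%:R = (-1) ^+ n * ((tan_poly n)`_0)%:~R.
Proof.
rewrite -fps_coef0_iter_deriv iterSr fps_deriv_tanh.
have -> : 1 - fps_tanh ^+ 2 = fps_horner (1 + 'X) tan_sq.
  by rewrite /fps_horner rmorphD rmorph1 /= map_polyX -polyC1 !hornerE.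
rewrite iter_deriv2_tan_sq rmorphM rmorph_sign /= fps_coef0_horner //.
by rewrite rmorphN rmorphXn /= fps_coef0_tanh expr0n oppr0.
Qed.

(** This is the coefficient of x^(2n+2) in x + b(4x) - b(2x), to which the
    term x does not contribute. *)
Lemma tanh_coef_bernoulli n :
  fps_tanh (2 * n).+1%N = (4 ^+ (2 * n.+1) - 2 ^+ (2 * n.+1))
    * (bernoulli (2 * n.+1) / (2 * n.+1)`!%:R).
Proof. by rewrite mulrBl mulnS -[LHS]/(0 + _ - _) add0r. Qed.

Lemma tangent_numberE n : tangent_number n.+1 = ((tan_poly n)`_0)%:~R.
Proof.
apply: (@mulfI _ ((-1) ^+ n)); first by rewrite signr_eq0.
rewrite -tanh_coefE tanh_coef_bernoulli /tangent_number.
have -> : 4 ^+ (2 * n.+1) = 2 ^+ (2 * n.+1) * 2 ^+ (2 * n.+1) :> rat.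
  by rewrite -exprMn -natrM.
rewrite mulnS add2n [in RHS]factS natrM exprS.
set t := 2 ^+ (2 * n).+2; set b := bernoulli _.
set d := (2 * n).+2%:R; set f := (2 * n).+1`!%:R.
have d0 : d != 0 by rewrite Num.Theory.pnatr_eq0.
have f0 : f != 0 by apply: fact_neq0.
have sq : (-1) ^+ n * (-1) ^+ n = 1 :> rat by rewrite -expr2 sqrr_sign.
transitivity (- ((-1) ^+ n * (-1) ^+ n) * t * (1 - t) * (b / d)); first by ring.
by clearbody t b d f; rewrite sq; field; rewrite f0.
Qed.

(** * Parity, sign and residue modulo 5 *)

Fact tan_step_is_additive : zmod_morphism tan_step.
Proof. by move=> p q; rewrite /tan_step !derivB; ring. Qed.

HB.instance Definition _ := GRing.isZmodMorphism.Build
  {poly int} {poly int} tan_step tan_step_is_additive.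

Lemma tan_step_tan_poly0 : tan_step (1 + 'X) = 2 + 8 * 'X + 6 * 'X ^+ 2.
Proof. by rewrite /tan_step !derivE; ring. Qed.

(** Two steps fix 1 + 'X modulo 5, and additivity of [tan_step] carries the
    congruence through the remaining n steps. *)
Lemma tan_poly_mod5 n :
  exists q : int, (tan_poly n.+2)`_0 = (tan_poly n)`_0 + 5 * q.
Proof.
rewrite /tan_poly 2!iterSr.
have -> : tan_step (tan_step (1 + 'X)) =
    1 + 'X + (3 + 27 * 'X + 48 * 'X ^+ 2 + 24 * 'X ^+ 3) *+ 5.
  by rewrite tan_step_tan_poly0 /tan_step !derivE /=; ring.
have iterD k a b :
    iter k tan_step (a + b *+ 5) = iter k tan_step a + iter k tan_step b *+ 5.
  by elim: k => //= k ->; rewrite raddfD raddfMn.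
rewrite iterD coefD coefMn.
set p := iter n tan_step _; set q := iter n tan_step _.
by exists q`_0; rewrite mulr_natl.
Qed.

Lemma tan_poly_even n : exists q : int, (tan_poly n.+1)`_0 = 2 * q.
Proof.
rewrite /tan_poly iterS /tan_step; set p := (X in 2 * X).
by exists p`_0; rewrite !mulr_natl coefMn.
Qed.

(** Stated for all sub-semirings, it covers the natural numbers, which give the
    sign. *)
Lemma tan_poly_over (S : semiringClosed int) n : tan_poly n \is a polyOver S.
Proof.
elim: n => [|n IHn]; first by rewrite rpredD ?rpred1 ?polyOverX //.
rewrite /tan_poly iterS -/(tan_poly n) /tan_step.
by rewrite !(rpredM, rpredD, rpredX, rpred1, rpred_nat, polyOverX,
  polyOver_deriv).
Qed.

Lemma tan_poly_nat n : (tan_poly n)`_0 \is a Num.nat.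
Proof. exact: polyOverP (@tan_poly_over _ n) 0%N. Qed.

Lemma tan_poly_modE n :
  ((tan_poly n)`_0 = (if odd n then 2 else 1) %[mod 5])%Z.
Proof.
elim/ltn_ind: n => -[|[|n]] IHn.
- by rewrite /= coefD coef1 coefX.
- rewrite /tan_poly iterS tan_step_tan_poly0 -!polyC_natr expr2 mulrA.
  by rewrite !coefD !coefMX coefC.
have [q ->] := tan_poly_mod5 n; have := IHn n (leqW (ltnSn n)).
rewrite /= negbK; case: odd; lia.
Qed.

Theorem corollary4 :
  exists T : nat -> int,
    (forall n : nat, (1 <= n)%N -> tangent_number n = (T n)%:~R) /\
    (forall n : nat, (2 <= n)%N ->
       last_digit (T n) = (if odd n then 6 else 2)%N) /\
    (forall n : nat, (1 <= n)%N ->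
       (T n = (if odd n then 1 else 2) %[mod 5])%Z).
Proof.
exists (fun n => (tan_poly n.-1)`_0); split; [|split].
- by case=> // n _; apply: tangent_numberE.
- case=> [//|[//|n]] _ /=; have := tan_poly_modE n.+1.
  have [q eqT] := tan_poly_even n.
  have := Num.Theory.natr_ge0 (tan_poly_nat n.+1).
  rewrite eqT /last_digit /= negbK; case: odd => /=; lia.
- by case=> // n _; rewrite tan_poly_modE /=; case: odd.
Qed.
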